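(* Let $X$ be a non-empty finite set, let $A$ be a finite group with a (not necessarily faithful) left action on $X$, and regard $A^{X^*}$ as the full tree shift group. Let $G$ be a subgroup of $A^{X^*}$. If the normalizer $N_{A^{X^*}}(G)$ of $G$ in $A^{X^*}$ contains a self-replicating, level-transitive subgroup, then $G$ is a sofic tree shift group if and only if $G$ is a finitely constrained group.
   Context: Trees and configurations. $X^*$ is the set of all finite words over $X$ (with empty word $\epsilon$), viewed as a rooted $|X|$-ary tree; $X^n$ is the set of words of length $n$ and $X^{(n)}=\bigcup_{i=0}^{n-1}X^i$. A configuration is a map $f:X^*\to A$; its label at $w$ is written $f_{(w)}$. The set of all configurations is $A^{X^*}$, with the prodiscrete (product) topology. For $w\in X^*$ the section (shift) $f_w\in A^{X^*}$ is defined by $(f_w)_{(u)}=f_{(wu)}$. Group structure. Each $g\in A^{X^*}$ acts on $X^*$ by $g(\epsilon)=\epsilon$ and $g(xw)=g_{(\epsilon)}(x)\,g_x(w)$ for $x\in X$, $w\in X^*$. The full tree shift group is $A^{X^*}$ with the product $(gh)_{(w)}=g_{(h(w))}h_{(w)}$ (the infinitely iterated permutational wreath product $A\wr_X A\wr_X\cdots$). A subgroup $H\le A^{X^*}$ is self-similar if $h_w\in H$ for all $h\in H$, $w\in X^*$. It is self-replicating if it is self-similar and for every $u\in X^*$ and every $g\in H$ there is $h\in H$ with $h(u)=u$ and $h_u=g$. It is level-transitive if it acts transitively on $X^n$ for every $n$. The normalizer is $N_{A^{X^*}}(G)=\{h\in A^{X^*} : h^{-1}gh\in G \text{ for all } g\in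 G\}$. Tree shifts. A tree shift is a subset of $A^{X^*}$ that is topologically closed and invariant under all shifts $f\mapsto f_w$. A pattern is a map $p:M\to A$ with $M\subset X^*$ finite and non-empty; it appears in $f$ at $w$ if $f_w|_M=p$. A tree shift of finite type is a set of the form $\{f\in A^{X^*} : \text{no } p\in\mathcal F \text{ appears in } f\}$ for some finite set $\mathcal F$ of patterns. Sofic tree shifts. An unrestricted Rabin automaton is a tuple $\mathcal A=(S,X,A,\mathcal T)$ with $S$ a non-empty finite set and $\mathcal T\subseteq S\times A\times S^X$. A configuration $f$ is accepted by $\mathcal A$ if there is a map $\alpha:X^*\to S$ with $(\alpha(w);f_{(w)};(\alpha(wx))_{x\in X})\in\mathcal T$ for all $w\in X^*$. A tree shift is sofic if it is the set of all configurations accepted by some unrestricted Rabin automaton. A finitely constrained group is a self-similar subgroup of $A^{X^*}$ that is a tree shift of finite type. A sofic tree shift group is a self-similar subgroup of $A^{X^*}$ that is a sofic tree shift. *)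

(* Defs.v *)
From HB Require Import structures.
From mathcomp Require Import all_boot all_fingroup finmap.
From mathcomp Require Import boolp classical_sets functions cardinality.
From mathcomp Require Import topology function_spaces.

Set Implicit Arguments.
Unset Strict Implicit.
Unset Printing Implicit Defensive.

Local Open Scope classical_set_scope.
Local Open Scope group_scope.

(* MathComp's {action A &-> X} is a right action, whereas the product of
   configurations below relies on the left action law. *)
Record left_action (A : finGroupType) (X : Type) := LeftAction {
  lact :> A -> X -> X;
  lact1 : forall x, lact 1 x = x;
  lactM : forall a b x, lact (a * b) x = lact a (lact b x)
}.

(* The type of configurations X^* -> A. The action plays no role in the
   carrier or in the prodiscrete topology; it is a parameter because the
   canonical group law of [config act] depends on it. *)
Definition config (A : finGroupType) (X : finType) (act : left_action A X) :=
  prod_topology (fun _ : seq X => discrete_topology A).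

HB.instance Definition _ (A : finGroupType) (X : finType)
    (act : left_action A X) := Topological.on (config act).

Section Config.
Variables (A : finGroupType) (X : finType) (act : left_action A X).
Implicit Types (f g h : config act) (w : seq X).

Definition label f w : A := f w.

Definition section f w : config act := fun u => label f (w ++ u).

Fixpoint tree_act g w : seq X :=
  if w is x :: w' then act (label g [::]) x :: tree_act (section g [:: x]) w'
  else [::].

Fixpoint tree_act_inv g w : seq X :=
  if w is y :: w' then
    let x := act (label g [::])^-1 y in x :: tree_act_inv (section g [:: x]) w'
  else [::].

Definition config_one : config act := fun=> 1.

Definition config_mul g h : config act :=
  fun w => label g (tree_act h w) * label h w.

Definition config_inv g : config act :=
  fun w => (label g (tree_act_inv g w))^-1.

Lemma section_cons f x w : section (section f [:: x]) w = section f (x :: w).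
Proof. by apply/funext => u. Qed.

Lemma section_mul1 g h x :
  section (config_mul g h) [:: x] =
  config_mul (section g [:: act (label h [::]) x]) (section h [:: x]).
Proof. by apply/funext => u. Qed.

Lemma tree_act_mul g h w :
  tree_act (config_mul g h) w = tree_act g (tree_act h w).
Proof.
elim: w g h => //= x w IHw g h.
by rewrite section_mul1 IHw {1}/label /config_mul /= lactM.
Qed.

Lemma tree_act1 w : tree_act config_one w = w.
Proof.
elim: w => //= x w IHw; rewrite /label /= lact1.
by rewrite (_ : section _ _ = config_one) ?IHw //; apply/funext.
Qed.

Lemma tree_actK g : cancel (tree_act g) (tree_act_inv g).
Proof.
move=> w; elim: w g => //= x w IHw g.
by rewrite -lactM mulVg lact1 IHw.
Qed.

Lemma tree_act_invK g : cancel (tree_act_inv g) (tree_act g).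
Proof.
move=> w; elim: w g => //= x w IHw g.
by rewrite IHw -lactM mulgV lact1.
Qed.

Lemma config_mulA : associative config_mul.
Proof.
move=> f g h; apply/funext => w.
by rewrite /config_mul /label tree_act_mul mulgA.
Qed.

Lemma config_mul1g : left_id config_one config_mul.
Proof. by move=> g; apply/funext => w; rewrite /config_mul /label mul1g. Qed.

Lemma config_mulg1 : right_id config_one config_mul.
Proof.
by move=> g; apply/funext => w; rewrite /config_mul /label tree_act1 mulg1.
Qed.

Lemma config_mulVg : left_inverse config_one config_inv config_mul.
Proof.
move=> g; apply/funext => w.
by rewrite /config_mul /config_inv /label tree_actK mulVg.
Qed.

Lemma tree_act_config_inv g w : tree_act (config_inv g) w = tree_act_inv g w.
Proof.
by rewrite -[w in LHS](tree_act_invK g) -tree_act_mul config_mulVg tree_act1.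
Qed.

Lemma config_mulgV : right_inverse config_one config_inv config_mul.
Proof.
move=> g; apply/funext => w.
by rewrite /config_mul {2}/label /config_inv tree_act_config_inv mulgV.
Qed.

End Config.

HB.instance Definition _ (A : finGroupType) (X : finType)
    (act : left_action A X) := isGroup.Build (config act)
  (@config_mulA A X act) (@config_mul1g A X act) (@config_mulg1 A X act)
  (@config_mulVg A X act) (@config_mulgV A X act).

Section TreeShiftGroups.
Variables (A : finGroupType) (X : finType) (act : left_action A X).
Implicit Types (f g h : config act) (w : seq X) (G H T : set (config act)).

Definition subgroup H : Prop := group_closed [in H].

Definition shift_invariant T : Prop :=
  forall f w, T f -> T (section f w).

Definition self_similar_subgroup H : Prop := subgroup H /\ shift_invariant H.

Definition self_replicating H : Prop :=
  self_similar_subgroup H /\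
  forall u g, H g -> exists h, [/\ H h, tree_act h u = u & section h u = g].

Definition level_transitive H : Prop :=
  forall (n : nat) (u v : n.-tuple X), exists2 h, H h & tree_act h u = v.

(* One-sided inclusion on purpose: h^-1 G h need not be all of G. *)
Definition normalizer G : set (config act) :=
  [set h | forall g, G g -> G (h^-1 * g * h)].

Definition tree_shift T : Prop := closed T /\ shift_invariant T.

(* A pattern is a finite map p with non-empty domain [domf p]. *)
Definition appears (p : {fmap seq X -> A}) f w : Prop :=
  forall u : domf p, label (section f w) (val u) = p u.

Definition tree_shift_of_finite_type T : Prop :=
  exists F : set {fmap seq X -> A},
    [/\ finite_set F, forall p, F p -> domf p != fset0 &
        T = [set f | forall p w, F p -> ~ appears p f w]].

End TreeShiftGroups.

Record rabin_automaton (A X : finType) := RabinAutomaton {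
  state : finType;
  state_nonempty : (0 < #|state|)%N;
  transition : {set state * A * {ffun X -> state}}
}.

Section Sofic.
Variables (A : finGroupType) (X : finType) (act : left_action A X).
Implicit Types (f : config act) (G T : set (config act)).

Definition accepted (M : rabin_automaton A X) f : Prop :=
  exists alpha : seq X -> state M, forall w,
    (alpha w, label f w, [ffun x => alpha (rcons w x)]) \in transition M.

Definition sofic_tree_shift T : Prop :=
  tree_shift T /\
  exists M : rabin_automaton A X, T = [set f | accepted M f].

Definition finitely_constrained_group G : Prop :=
  self_similar_subgroup G /\ tree_shift_of_finite_type G.

Definition sofic_tree_shift_group G : Prop :=
  self_similar_subgroup G /\ sofic_tree_shift G.

End Sofic.

(* Main.v *)
Require Import Defs.
From mathcomp Require Import all_boot all_fingroup finmap.
From mathcomp Require Import boolp classical_sets cardinality filter.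
From mathcomp Require Import topology function_spaces.

(** A tree shift of finite type is sofic because an automaton whose states are
    the legal patterns of a fixed depth can check it ([finite_type_sofic]).

    For the converse, let [G] be a sofic group and write [graft g w h] for the
    configuration [g] whose subtree below [w] has been replaced by [h]. For
    [g] in [G], the set of [h] such that [graft g w h] lies in [G] is the left
    coset of [section g w] modulo the subgroup [rigid G w] of all [k] such that
    [k] placed below [w], and [1] everywhere else, gives an element of [G]
    ([graft_rigid]). Two facts about these cosets drive the proof.

    - An automaton sees of the outside of the subtree below [w] only the set of
      states that a run can have at [w]; so only finitely many cosets occur,
      over all [g] and all [w] ([sofic_contexts]).
    - Conjugating by elements of the level-transitive group [H] moves
      [rigid G u] to [rigid G w] up to conjugation by a section of [H], and
      self-replication makes [rigid G w] invariant under [H]; hence [rigid G w]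
      depends only on the length of [w] ([rigid_level]). Self-similarity makes
      it decrease with that length, so by the first fact it is eventually a
      constant subgroup [K], from some level [N] on ([rigid_stable]).

    Now finitely many closed cosets of [K] remain, and distinct ones are
    separated by their patterns of some common depth [m] ([coset_of_pattern]).
    If all patterns in [f] on the words of length at most [N + m] come from
    [G], approximations of [f] by elements of [G] can then be improved one
    level at a time: sections
    supplied by the patterns lie in the coset that the approximation dictates,
    so they may be grafted into it ([patterns_in_subgroup]). As [G] is closed,
    [f] is in [G], and thus the finitely many patterns on this domain which do
    not come from [G] define [G]. *)

Set Implicit Arguments.
Unset Strict Implicit.
Unset Printing Implicit Defensive.
Local Open Scope classical_set_scope.
Local Open Scope group_scope.

(** * Prefixes of words *)

Section Words.
Variable X : eqType.
Implicit Types (u v w : seq X).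

Lemma prefix_size_eq u v : size u = size v -> prefix u v = (u == v).
Proof. by move=> e; rewrite prefixE e take_size eq_sym. Qed.

Lemma prefix_rconsE w v x :
  prefix w (rcons v x) = prefix w v || (w == rcons v x).
Proof.
apply/idP/idP.
  move=> /prefixP[s]; case/lastP: s => [|s y].
    by rewrite cats0 => ->; rewrite eqxx orbT.
  by rewrite -rcons_cat => /rcons_inj[-> _]; rewrite prefix_prefix.
case/orP=> [/prefixP[s ->]|/eqP ->]; last exact: prefix_refl.
by rewrite rcons_cat prefix_prefix.
Qed.
End Words.

(** * Action and sections *)

Section Tree.
Variables (A : finGroupType) (X : finType) (act : left_action A X).
Implicit Types (f g h k : config act) (u v w : seq X) (G H T : set (config act)).

Lemma mulE g h w : (g * h) w = g (tree_act h w) * h w :> A.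
Proof. by []. Qed.

Lemma section0 f : section f [::] = f.
Proof. by apply/funext. Qed.

Lemma section_cat f u v : section (section f u) v = section f (u ++ v).
Proof. by apply/funext => z; rewrite /section /label catA. Qed.

Lemma tree_act_cat g u v :
  tree_act g (u ++ v) = tree_act g u ++ tree_act (section g u) v.
Proof.
elim: u g => [|x u IH] g /=; first by rewrite section0.
by rewrite IH section_cons.
Qed.

Lemma size_tree_act g u : size (tree_act g u) = size u.
Proof. by elim: u g => //= x u IH g; rewrite IH. Qed.

Lemma tree_act_one u : tree_act (1 : config act) u = u.
Proof. exact: tree_act1. Qed.

Lemma section_one w : section (1 : config act) w = 1.
Proof. by apply/funext. Qed.

Lemma tree_act_inj g : injective (tree_act g).
Proof. exact: can_inj (tree_actK g). Qed.

Lemma section_mul g h w :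
  section (g * h) w = section g (tree_act h w) * section h w.
Proof. by apply/funext => u; rewrite mulE /section /label mulE tree_act_cat. Qed.

Lemma section_inv g w : section g^-1 (tree_act g w) = (section g w)^-1.
Proof.
rewrite -[RHS]mul1g; apply/(canRL (mulgK _)).
by rewrite -section_mul mulVg section_one.
Qed.

Lemma prefix_tree_act g w v : prefix (tree_act g w) (tree_act g v) = prefix w v.
Proof.
rewrite !prefixE size_tree_act -[in LHS](cat_take_drop (size w) v) tree_act_cat.
case: (leqP (size w) (size v)) => lwv.
  rewrite take_size_cat ?size_tree_act ?size_takel //.
  by rewrite (inj_eq (@tree_act_inj g)).
rewrite -tree_act_cat cat_take_drop !take_oversize ?size_tree_act ?(ltnW lwv) //.
by rewrite (inj_eq (@tree_act_inj g)).
Qed.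

Lemma tree_act_eq g g' v : (forall u, prefix u v -> u != v -> g u = g' u) ->
  tree_act g v = tree_act g' v.
Proof.
elim: v g g' => //= x v IH g g' e.
rewrite /label (e [::]) //; congr (_ :: _); apply: IH => u uv nuv.
by apply: (e (x :: u)); rewrite ?prefix_cons ?eqseq_cons ?eqxx.
Qed.

(** * Agreement up to a given depth *)

Definition agree n f g := forall u, (size u < n)%N -> f u = g u.

Lemma agreeS m n f g : (m <= n)%N -> agree n f g -> agree m f g.
Proof. by move=> lmn e u lu; apply: e; apply: leq_trans lmn. Qed.

Lemma agree_sym n f g : agree n f g -> agree n g f.
Proof. by move=> e u lu; rewrite e. Qed.

Lemma agree_trans n g f h : agree n f g -> agree n g h -> agree n f h.
Proof. by move=> e e' u lu; rewrite e ?e'. Qed.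

Lemma agree_mulr n f g h : agree n f g -> agree n (f * h) (g * h).
Proof. by move=> e u lu; rewrite !mulE e ?size_tree_act. Qed.

Lemma agree_section n m w f g : (size w + m <= n)%N ->
  agree n f g -> agree m (section f w) (section g w).
Proof.
move=> l e u lu; apply: e; apply: leq_trans l.
by rewrite size_cat ltn_add2l.
Qed.

(** * Grafting a subtree *)

Definition graft g w h : config act :=
  fun v => if prefix w v then h (drop (size w) v) else g v.

Lemma graft_cat g w h u : graft g w h (w ++ u) = h u.
Proof. by rewrite /graft prefix_prefix drop_size_cat. Qed.

Lemma graft_off g w h v : ~~ prefix w v -> graft g w h v = g v.
Proof. by rewrite /graft => /negPf ->. Qed.

Lemma section_graft g w h : section (graft g w h) w = h.
Proof. by apply/funext => u; apply: graft_cat. Qed.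

Lemma section_graft_ne g w h w' : size w' = size w -> w' != w ->
  section (graft g w h) w' = section g w'.
Proof.
move=> e ne; apply/funext => u; apply: graft_off.
rewrite prefixE take_cat -e ltnn subnn take0 cats0; exact: ne.
Qed.

Lemma graft_id g w : graft g w (section g w) = g.
Proof.
apply/funext => v; rewrite /graft; case: ifP => // /prefixP[u ->].
by rewrite drop_size_cat.
Qed.

Lemma agree_graft n g w h k : agree n h k ->
  agree (size w + n) (graft g w h) (graft g w k).
Proof.
move=> e v lv; rewrite /graft; case: ifP => // /prefixP[u vE].
apply: e; move: lv; rewrite vE drop_size_cat // size_cat.
by rewrite ltn_add2l.
Qed.

Lemma tree_act_graft_off g w h v : ~~ prefix w v ->
  tree_act (graft g w h) v = tree_act g v.
Proof.
move=> nwv; apply: tree_act_eq => u uv _; apply: graft_off.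
by apply: contra nwv => wu; apply: prefix_trans wu uv.
Qed.

Lemma tree_act_graft g w h u :
  tree_act (graft g w h) (w ++ u) = tree_act g w ++ tree_act h u.
Proof.
rewrite tree_act_cat section_graft; congr (_ ++ _).
apply: tree_act_eq => v vw nvw; apply: graft_off; apply: contra nvw => wv.
move/size_prefix: (wv) (size_prefix vw) => l1 l2.
by rewrite eq_sym -prefix_size_eq //; apply/eqP; rewrite eqn_leq l1.
Qed.

(** The action of [graft g' w h'] maps the subtree below [w] to the one below
    [tree_act g' w], and the complement of the first to that of the second, so
    products may be computed separately on both parts. All coset and conjugation
    computations are instances of this identity. *)
Lemma graft_mul g g' w h h' :
  graft g (tree_act g' w) h * graft g' w h' = graft (g * g') w (h * h').
Proof.
apply/funext => v; rewrite mulE.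
have [/prefixP[u ->]|nwv] := boolP (prefix w v).
  by rewrite tree_act_graft !graft_cat.
by rewrite tree_act_graft_off // !graft_off // prefix_tree_act.
Qed.

Lemma inv_mul_graft g w h :
  g^-1 * graft g w h = graft 1 w ((section g w)^-1 * h).
Proof.
rewrite -{1}(graft_id g^-1 (tree_act g w)) section_inv.
by rewrite graft_mul mulVg.
Qed.

Lemma conj_graft k w h :
  h^-1 * graft 1 (tree_act h w) k * h =
  graft 1 w ((section h w)^-1 * k * section h w).
Proof.
rewrite -{1}(graft_id h^-1 (tree_act h w)) section_inv.
rewrite -{1}(tree_act_one (tree_act h w)) graft_mul mulg1.
by rewrite -[X in _ * X = _](graft_id h w) graft_mul mulVg.
Qed.

(** * Rigid subgroups *)

Section Subgroup.
Variable G : set (config act).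
Hypothesis gG : subgroup G.

Lemma subgroup1 : G 1. Proof. by apply/set_mem; case: gG. Qed.

Lemma subgroupM g h : G g -> G h -> G (g * h).
Proof. by move=> /mem_set a /mem_set b; apply/set_mem/(group_closedM gG). Qed.

Lemma subgroupV g : G g -> G g^-1.
Proof. by move=> /mem_set a; apply/set_mem/(group_closedV gG). Qed.

Lemma subgroup_mull g h : G g -> G (g * h) -> G h.
Proof. by move=> Gg /(subgroupM (subgroupV Gg)); rewrite mulKg. Qed.
End Subgroup.

Definition rigid G w : set (config act) := [set k | G (graft 1 w k)].

Lemma graft_rigid G g w h : subgroup G -> G g ->
  G (graft g w h) <-> rigid G w ((section g w)^-1 * h).
Proof.
move=> gG Gg; rewrite /rigid /= -inv_mul_graft; split=> [Gh|].
  by apply: subgroupM => //; apply: subgroupV.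
by apply: subgroup_mull => //; apply: subgroupV.
Qed.

Lemma rigid_subgroup G w : subgroup G -> subgroup (rigid G w).
Proof.
move=> gG; split.
  apply/mem_set; rewrite /rigid /= -(section_one w) graft_id; exact: subgroup1.
move=> h k /set_mem Gh /set_mem Gk; apply/mem_set.
have Gk1 : G (graft 1 w k)^-1 by apply: subgroupV.
have := subgroupM gG Gh Gk1; rewrite /rigid /=.
suff -> : (graft 1 w k)^-1 = graft 1 w k^-1.
  by rewrite -{1}(tree_act_one w) graft_mul mulg1.
rewrite -[LHS]mul1g; apply/(canLR (mulgK _)).
by rewrite -{1}(tree_act_one w) graft_mul mulg1 mulVg -(section_one w) graft_id.
Qed.

Lemma rigid_conj G h w k : normalizer G h -> rigid G (tree_act h w) k ->
  rigid G w ((section h w)^-1 * k * section h w).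
Proof. by rewrite /rigid /= => nh /nh; rewrite conj_graft. Qed.

Lemma rigid_tail G u w : shift_invariant G -> rigid G (u ++ w) `<=` rigid G w.
Proof.
move=> sG k /= /(sG _ u); rewrite /rigid /=.
suff -> : section (graft 1 (u ++ w) k) u = graft 1 w k by [].
apply/funext => v; rewrite /section /label.
by rewrite /graft prefix_catr // eqxx size_cat addnC -drop_drop drop_size_cat.
Qed.

Section Normalizer.
Variables G H : set (config act).
Hypotheses (nH : H `<=` normalizer G) (rH : self_replicating H).
Hypothesis tH : level_transitive H.

(** Level-transitivity provides [h] in [H] moving [w] to [u]; conjugation by
    [h] carries [rigid G u] into [rigid G w] up to conjugation by the section
    of [h] at [w]. This is undone by an element of [H] that fixes [w] and has
    the inverse section there, which exists by self-replication. *)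
Lemma rigid_level u w : size u = size w -> rigid G u `<=` rigid G w.
Proof.
move=> suw k Gk; case: rH => -[gH sH] repH.
have [h Hh hw] := @tH (size w) (in_tuple w) (tcast suw (in_tuple u)).
rewrite val_tcast /= in hw; rewrite -hw in Gk.
have Gw := rigid_conj (nH Hh) Gk.
have [h' [Hh' h'w h'E]] := repH w _ (subgroupV gH (sH _ w Hh)).
rewrite -h'w in Gw; have := rigid_conj (nH Hh') Gw.
by rewrite h'w h'E invgK !mulgA mulgV mul1g mulgK.
Qed.

(** A word has suffixes of all smaller lengths, and passing to a suffix enlarges
    the rigid subgroup. *)
Lemma rigid_anti u w : shift_invariant G -> (size u <= size w)%N ->
  rigid G w `<=` rigid G u.
Proof.
move=> sG luw; rewrite -(cat_take_drop (size w - size u) w).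
apply: (subset_trans (rigid_tail sG)); apply: rigid_level.
by rewrite size_drop subKn.
Qed.
End Normalizer.

(** * Stabilization of the rigid subgroups *)

(** This is what the finiteness of an automaton gives: only finitely many sets
    of continuations occur below the vertices of elements of [G]. The type [C]
    need not name them faithfully. *)
Definition finite_contexts G :=
  exists (C : finType) (c : config act -> seq X -> C),
  forall g g' w w' h, G g -> G g' -> c g w = c g' w' ->
    G (graft g w h) -> G (graft g' w' h).

Lemma frequent_value (C : finType) (c : nat -> C) :
  exists N, forall n, exists2 m, (n <= m)%N & c m = c N.
Proof.
have [[x xP]|nx] :=
  pselect (exists x, forall n, exists2 m, (n <= m)%N & c m = x).
  have [N _ cN] := xP 0; exists N => n; have [m lm cm] := xP n.
  by exists m; rewrite ?cm.
have /choice[b bP] : forall x, exists n, forall m, (n <= m)%N -> c m <> x.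
  move=> x; apply: contrapT => nb; apply: nx; exists x => n.
  apply: contrapT => nm; apply: nb; exists n => m lm cm; apply: nm; by exists m.
by have := bP (c (\max_x b x)) (\max_x b x) (leq_bigmax _).
Qed.

(** The rigid subgroup at [w] is the set of continuations of [1] below [w], so
    only finitely many occur. A value taken infinitely often by a decreasing
    sequence is its eventual value. *)
Lemma rigid_stable G H : (0 < #|X|)%N -> shift_invariant G -> subgroup G ->
  H `<=` normalizer G -> self_replicating H -> level_transitive H ->
  finite_contexts G ->
  exists N, forall u w, (N <= size u)%N -> (N <= size w)%N ->
    rigid G u `<=` rigid G w.
Proof.
move=> /card_gt0P[x0 _] sG gG nH rH tH [C [c cP]].
have [N NP] := frequent_value (fun n => c 1 (nseq n x0)).
have down u w := @rigid_anti G H nH rH tH u w sG.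
exists N => u w lu lw; have [m lm cm] := NP (size w).
apply: (subset_trans (@down (nseq N x0) u _)); rewrite ?size_nseq //.
apply: (@subset_trans _ (rigid G (nseq m x0))); last first.
  by apply: down; rewrite size_nseq.
by move=> k; apply: cP; [exact: subgroup1 | exact: subgroup1 | ].
Qed.

(** * Separating cosets by patterns *)

(** Topological closedness in terms of patterns; see [closed_agreeP]. *)
Definition agree_closed T := forall f,
  (forall n, exists2 g, T g & agree n f g) -> T f.

(** For two fixed contexts, of [g] at [w] and of [g'] at [w'], the sections
    found in the first lie in one coset and those found in the second in one
    coset as well. If for every depth some members of both agree, then
    closedness puts [section g' w'] into the coset of [section g w]. So each
    pair of contexts has a depth that separates its cosets when they differ,
    and the maximum over the finitely many pairs works uniformly. *)
Lemma coset_of_pattern G N : subgroup G -> agree_closed G ->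
  (forall u w, (N <= size u)%N -> (N <= size w)%N ->
    rigid G u `<=` rigid G w) ->
  finite_contexts G ->
  exists m, forall g g' w w', G g -> G g' -> (N <= size w)%N -> (N <= size w')%N ->
    agree m (section g w) (section g' w') -> G (graft g w (section g' w')).
Proof.
move=> gG cG stN [C [c cP]].
pose occurs q g w := [/\ G g, (N <= size w)%N & c g w = q].
have /choice[m mP] : forall q : C * C, exists m, forall g g' w w',
    occurs q.1 g w -> occurs q.2 g' w' -> agree m (section g w) (section g' w') ->
    G (graft g w (section g' w')).
  move=> [q q'] /=.
  have [[[g [w [Gg lw gw]]] [g' [w' [Gg' lw' gw']]]]|no] := pselect
    ((exists g w, occurs q g w) /\ (exists g w, occurs q' g w)); last first.
    exists 0 => g g' w w' o o'; case: no; split; by do 2 eexists; eauto.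
  apply: contrapT => no.
  suff Gb : G (graft g w (section g' w')).
    apply: no; exists 0 => g1 g1' w1 w1' [Gg1 lw1 gw1] [Gg1' lw1' gw1'] _.
    apply: (cP g g1 w w1) => //; first by rewrite gw.
    have G1 : G (graft g' w' (section g1' w1')).
      by apply: (cP g1' g' w1' w'); rewrite ?gw1' ?graft_id.
    move/(graft_rigid _ _ gG Gg): Gb => Gb; apply/(graft_rigid _ _ gG Gg).
    move/(graft_rigid _ _ gG Gg')/(stN _ w lw' lw): G1 => G1.
    have := subgroupM (rigid_subgroup w gG) Gb G1.
    by rewrite mulgA mulgK.
  apply: cG => n.
  have : exists2 k, G (graft g w k) & agree n k (section g' w').
    apply: contrapT => nk; apply: no; exists n.
    move=> g1 g1' w1 w1' [Gg1 lw1 gw1] [Gg1' lw1' gw1'] e.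
    case: nk; pose a := section g1 w1; pose b := section g1' w1'.
    (* [a] and [b] agree to depth [n], hence so do [a * z] and [b * z] for
       every [z]; this [z] makes the second product [section g' w'] and leaves
       the first one in the coset of [a], as [z] belongs to the rigid
       subgroup. *)
    exists (a * (b^-1 * section g' w')).
      have Ga : G (graft g w a) by apply: (cP g1 g w1 w); rewrite ?gw1 ?graft_id.
      have Gb : G (graft g1' w1' (section g' w')).
        by apply: (cP g' g1' w' w1'); rewrite ?gw1' ?graft_id.
      move/(graft_rigid _ _ gG Gg): Ga => Ga; apply/(graft_rigid _ _ gG Gg).
      move/(graft_rigid _ _ gG Gg1')/(stN _ w lw1' lw): Gb => Gb.
      by rewrite mulgA; apply: subgroupM => //; apply: rigid_subgroup.
    by have := agree_mulr (b^-1 * section g' w') e; rewrite mulKVg.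
  move=> [k Gk e]; exists (graft g w k) => //.
  by apply: (agreeS _ (agree_graft _ (agree_sym e))); apply: leq_addl.
exists (\max_q m q) => g g' w w' Gg Gg' lw lw' e.
apply: (mP (c g w, c g' w')) => //; apply: (agreeS _ e); exact: leq_bigmax.
Qed.

(** * From patterns to the group *)

Lemma graft_level G g L (k : seq X -> config act) : subgroup G -> G g ->
  (forall w, size w = L -> G (graft g w (k w))) ->
  exists g', [/\ G g', agree L g' g &
    forall w, size w = L -> section g' w = k w].
Proof.
move=> gG Gg Gk.
suff [g' [Gg' e P]] : exists g', [/\ G g', agree L g' g &
    forall w, size w = L -> section g' w =
      if w \in map val (enum {: L.-tuple X}) then k w else section g w].
  exists g'; split=> // w sw; rewrite P //; case: ifP => // /negP[].
  apply/mapP; exists (tcast sw (in_tuple w)); first by rewrite mem_enum.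
  by rewrite /= val_tcast.
elim: (enum _) => [|t s [g' [Gg' e P]]]; first by exists g.
have [ts|nts] := boolP (val t \in map val s).
  exists g'; split=> // w sw; rewrite P //= inE; case: eqP => //= ->.
  by rewrite ts.
exists (graft g' t (k t)); split.
- apply/(graft_rigid _ _ gG Gg'); rewrite P ?size_tuple // (negPf nts).
  by apply/(graft_rigid _ _ gG Gg)/Gk; rewrite size_tuple.
- move=> u lu; rewrite graft_off ?e //; apply: contraL lu => /size_prefix.
  by rewrite size_tuple -leqNgt.
move=> w sw; rewrite /= inE; have [->|ne] := eqVneq w t.
  exact: section_graft.
by rewrite section_graft_ne ?P // size_tuple.
Qed.

Definition patterns_in n G f := forall w, exists2 g, G g & agree n g (section f w).

(** If [g] in [G] agrees with [f] on one level less than required, a pattern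
    of [f] at a word of length [j.+1], extended to [p] in [G], agrees with the
    section of [g] except possibly on its last level. Hence [N] levels further
    down the sections of [p] and [g] still agree to depth [m] and lie in the
    same coset; grafting those of [p] into [g] gains a level. *)
Lemma patterns_in_subgroup G N m : subgroup G -> agree_closed G ->
  (forall g g' w w', G g -> G g' -> (N <= size w)%N -> (N <= size w')%N ->
    agree m (section g w) (section g' w') -> G (graft g w (section g' w'))) ->
  forall f, patterns_in (N + m).+1 G f -> G f.
Proof.
move=> gG cG sep f lf; apply: cG.
suff ext j : exists2 g, G g & agree (N + m + j).+1 f g.
  move=> n; have [g Gg e] := ext n; exists g => //; apply: (agreeS _ e).
  by rewrite ltnW // ltnS leq_addl.
elim: j => [|j [g Gg e]].
  by have [g Gg] := lf [::]; rewrite section0 addn0; exists g => //; apply: agree_sym.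
have /choice[p pP] : forall w, exists g, G g /\ agree (N + m).+1 g (section f w).
  by move=> w; have [h] := lf w; exists h.
(* Grafting takes place [N] levels below the words of length [j.+1]: sections
   of [p _] at words of length [N] and of [g] at words of length [L] are both
   in the range where rigid subgroups are stable. *)
pose L := (j.+1 + N)%N.
pose k w := section (p (take j.+1 w)) (drop j.+1 w).
have [|g' [Gg' e' kP]] := @graft_level G g L k gG Gg.
  move=> w sw; have [Gp ep] := pP (take j.+1 w).
  have sd : size (drop j.+1 w) = N by rewrite size_drop sw /L addKn.
  apply: sep; rewrite ?sw ?sd ?leq_addl //.
  have -> : section g w = section (section g (take j.+1 w)) (drop j.+1 w).
    by rewrite section_cat cat_take_drop.
  apply: (@agree_section (N + m)); first by rewrite sd.
  apply: (@agree_trans _ (section f (take j.+1 w))).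
    apply: agree_section (agree_sym e).
    by rewrite size_takel ?sw ?leq_addr // addSn addnC.
  by apply: agree_sym; apply: (agreeS _ ep).
exists g' => // u lu.
have [uL|Lu] := ltnP (size u) L.
  rewrite e' // e //; apply: leq_trans uL _.
  by rewrite /L addSn ltnS addnC leq_add2r leq_addr.
rewrite -(cat_take_drop L u); set w := take L u.
have sw : size w = L by rewrite size_takel.
have -> : g' (w ++ drop L u) = section g' w (drop L u) by [].
have [_ ep] := pP (take j.+1 w).
rewrite kP // /k /section /label ep /section /label ?catA ?cat_take_drop //.
rewrite size_cat !size_drop sw /L addKn.
by rewrite ltnS leq_add2l leq_subLR -addnA addnC.
Qed.

(** * Closed sets and tree shifts of finite type *)

Lemma nbhs_label f u : nbhs f [set g : config act | f u = g u].
Proof.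
have := @proj_continuous (seq X) (fun=> discrete_topology A) u f.
move=> /(_ [set a | f u = a]); apply.
by apply: filterS (discrete_set1 _) => a ->.
Qed.

Lemma nbhs_agree f n : nbhs f [set g | agree n f g].
Proof.
have : nbhs f [set g : config act | forall u : n.-bseq X, f u = g u].
  have := @filter_forall _ _ (fun (u : n.-bseq X) (g : config act) => f u = g u) (nbhs f).
  apply=> u; exact: nbhs_label.
apply: filterS => g fg u su; exact: (fg (Bseq (ltnW su))).
Qed.

Lemma closed_agreeP T : closed T <-> agree_closed T.
Proof.
split=> [cT f fT|aT f fT]; last first.
  by apply: aT => n; have [g [Tg e]] := fT _ (nbhs_agree f n); exists g.
have /choice[g gP] n : exists g, T g /\ agree n f g.
  by have [g] := fT n; exists g.
apply: (@closed_cvg _ _ (nbhs \oo) _ g T cT).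
  by apply: nearW => n; have [] := gP n.
apply/cvg_sup => u B [O [[U oU <-] Uf] OB]; apply: filterS OB _.
exists (size u).+1 => // n /= lu; have [_ e] := gP n.
by change (U (g n u)); rewrite -(e u lu).
Qed.

(** Forbidding only patterns on one common domain, the words of length at most
    [n], makes their set finite. *)
Lemma patterns_in_finite_type G n : shift_invariant G ->
  (forall f, patterns_in n.+1 G f -> G f) -> tree_shift_of_finite_type G.
Proof.
move=> sG lG.
pose D : {fset seq X} := seq_fset tt (map val (enum {: n.-bseq X})).
have inD u : (u \in D) = (size u < n.+1)%N.
  rewrite seq_fsetE; apply/mapP/idP => [[b _ ->]|su]; first exact: size_bseq.
  by exists (Bseq su); rewrite ?mem_enum.
pose occ (q : {ffun D -> A}) := exists2 g, G g & forall u : D, g (val u) = q u.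
exists [set FinMap q | q in [set q : {ffun D -> A} | ~ occ q]]; split.
- by apply: finite_image; apply: finite_finset.
- move=> _ [q _ <-] /=; apply/fset0Pn; exists [::]; by rewrite inD.
apply/seteqP; split=> [f Gf _ w [q nq <-] ap|f nf].
  by apply: nq; exists (section f w) => //; apply: sG.
apply: lG => w; apply: contrapT => nl.
pose q := [ffun u : D => section f w (val u) : A].
apply: (nf (FinMap q) w); last by move=> u; rewrite ffunE.
exists q => // -[g Gg gq]; apply: nl; exists g => // u su.
have uD : u \in D by rewrite inD.
by have := gq [` uD]%fset; rewrite ffunE.
Qed.

(** * Sofic tree shifts *)

(** The context of [f] at [w] is the set of states at [w] of runs that obey the
    transitions outside the subtree below [w]. A run of any accepted
    [graft g w h], cut at [w], can be glued to such an outer run of [g'] at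
    [w'] which has the same state there. *)
Lemma sofic_contexts G : sofic_tree_shift G -> finite_contexts G.
Proof.
move=> [_ [M ->]].
pose runs (alpha : seq X -> state M) f v :=
  (alpha v, label f v, [ffun x => alpha (rcons v x)]) \in transition M.
pose ctx f w : {set state M} :=
  [set s | `[< exists alpha,
    alpha w = s /\ forall v, ~~ prefix w v -> runs alpha f v >]]%SET.
exists {set state M}, ctx => g g' w w' h _ _ eqc [alpha aP].
have : alpha w \in ctx g w.
  rewrite inE; apply/asboolP; exists alpha; split=> // v nv.
  by have := aP v; rewrite /runs /label graft_off.
rewrite eqc inE => /asboolP[beta [bw' bP]].
exists (fun v => if prefix w' v then alpha (w ++ drop (size w') v) else beta v) => v.
have [/prefixP[u ->]|nv] := boolP (prefix w' v).
  have aPu := aP (w ++ u); apply: etrans aPu.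
  rewrite /label !graft_cat drop_size_cat //.
  congr ((_, _, _) \in transition M); apply/ffunP => x; rewrite !ffunE.
  by rewrite !rcons_cat prefix_prefix drop_size_cat.
apply: etrans (bP v nv); rewrite /runs /label graft_off //.
congr ((_, _, _) \in transition M); apply/ffunP => x; rewrite !ffunE.
rewrite prefix_rconsE (negPf nv) /=; case: eqP => // <-.
by rewrite drop_size cats0.
Qed.

Lemma finite_type_closed T : tree_shift_of_finite_type T -> closed T.
Proof.
move=> [F [_ _ ->]]; apply/closed_agreeP => f fP p w Fp ap.
have [g gP e] := fP (size w + \max_(u : domf p) (size (val u)).+1)%N.
apply: (gP p w Fp) => u; rewrite -ap /label /section /label; apply/esym/e.
rewrite size_cat ltn_add2l.
exact: (leq_bigmax (F := fun u : domf p => (size (val u)).+1)).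
Qed.

Lemma finite_type_shift_invariant T : tree_shift_of_finite_type T -> shift_invariant T.
Proof.
move=> [F [_ _ ->]] f w fP p v Fp; rewrite /appears section_cat.
exact: fP.
Qed.

(** An automaton guesses at each vertex the pattern below it, checks that no
    forbidden pattern occurs in the guess, and that guesses at a vertex and its
    children overlap consistently. *)
Lemma finite_type_sofic T : tree_shift_of_finite_type T -> sofic_tree_shift T.
Proof.
move=> ft; split.
  by split; [exact: finite_type_closed|exact: finite_type_shift_invariant].
case: ft => F [finF neF TE].
have [n nP] : exists n, forall p, F p -> forall u : domf p, (size (val u) <= n)%N.
  have [Y YF] := (finite_fsetP.1 finF).
  exists (\max_(p : Y) \max_(u : domf (val p)) size (val u)) => p; rewrite YF => /= pY u.
  apply: leq_trans (leq_bigmax [` pY]%fset).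
  exact: (leq_bigmax (F := fun u : domf p => size (val u))).
(* The state at a vertex is to be the pattern of depth [n] below it;
   [insub_bseq] is only relevant on words of length at most [n], where it is
   faithful. *)
pose S := {ffun n.-bseq X -> A}.
have S0 : (0 < #|S|)%N by apply/card_gt0P; exists [ffun=> 1].
pose read (s : S) u := s (insub_bseq n u).
pose legal (s : S) := `[< forall p, F p -> ~ forall u : domf p, read s (val u) = p u >].
pose trans : {set S * A * {ffun X -> S}} :=
  [set t : S * A * {ffun X -> S} | [&& legal t.1.1, read t.1.1 [::] == t.1.2 &
    [forall x, [forall u : n.-bseq X, (size u < n)%N ==>
       (read t.1.1 (x :: u) == t.2 x u)]]]]%SET.
exists (RabinAutomaton S0 trans); rewrite {}TE; apply/seteqP; split=> f.
  move=> fP.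
  pose alpha w : S := [ffun u : n.-bseq X => section f w (val u)].
  have readE w u : (size u <= n)%N -> read (alpha w) u = section f w u.
    by move=> su; rewrite /read ffunE /insub_bseq /= val_insubd su.
  exists alpha => w; rewrite inE /=; apply/and3P; split.
  - apply/asboolP => p Fp ap; apply: (fP p w Fp) => u.
    by rewrite -ap readE // nP.
  - by rewrite readE // /section cats0.
  apply/forallP => x; apply/forallP => u; apply/implyP => su.
  by rewrite readE // !ffunE /section cat_rcons.
move=> [alpha aP] p w Fp ap.
have readE u v : (size u <= n)%N -> read (alpha v) u = f (v ++ u).
  elim: u v => [|x u IH] v su.
    by have := aP v; rewrite inE /= => /and3P[_ /eqP -> _]; rewrite cats0.
  have := aP v; rewrite inE /= => /and3P[_ _ /forallP/(_ x)/forallP].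
  move=> /(_ (insub_bseq n u)).
  rewrite /insub_bseq val_insubd (ltnW su) su /= => /eqP ->.
  by rewrite ffunE -cat_rcons -IH ?(ltnW su).
have := aP w; rewrite inE /= => /and3P[/asboolP/(_ p Fp) + _ _]; apply => u.
by rewrite readE ?nP // -ap.
Qed.

End Tree.

Theorem theoremA (X : finType) (A : finGroupType) (act : left_action A X)
    (G : set (config act)) :
  (0 < #|X|)%N ->
  subgroup G ->
  (exists H : set (config act),
      [/\ H `<=` normalizer G, self_replicating H & level_transitive H]) ->
  sofic_tree_shift_group G <-> finitely_constrained_group G.
Proof.
move=> X0 gG [H [nH rH tH]]; split=> -[ssG hG]; split=> //; last first.
  exact: finite_type_sofic.
have [_ sG] := ssG; have [[/closed_agreeP cG _] _] := hG.
have fc := sofic_contexts hG.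
have [N stN] := rigid_stable X0 sG gG nH rH tH fc.
have [m sep] := coset_of_pattern gG cG stN fc.
exact: patterns_in_finite_type sG (patterns_in_subgroup gG cG sep).
Qed.
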